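(* Let $\Omega$ be a semigroup, $(L,\mu,p)$ a Hom-associative algebra, $(V,\mu_l,\mu_r,q)$ a bimodule over it, $\Phi$ a 2-cocycle of $L$ with coefficients in $V$, and $\{R_\alpha:V\to L\}_{\alpha\in\Omega}$ a $\Phi$-twisted Rota-Baxter family operator. Then $(V,\{\prec_\alpha,\succ_\alpha,\curlyvee_{\alpha,\beta}\}_{\alpha,\beta\in\Omega},q)$ is a Hom-NS-family algebra, where $$u\prec_\alpha v=u\cdot_r R_\alpha v,\qquad u\succ_\alpha v=R_\alpha u\cdot_l v,\qquad u\curlyvee_{\alpha,\beta}v=\Phi(R_\alpha u,R_\beta v)\qquad(u,v\in V,\ \alpha,\beta\in\Omega).$$ Furthermore, let $(L',\mu',p')$ be a Hom-associative algebra with bimodule $(V',\mu'_l,\mu'_r,q')$, $\Phi'$ a 2-cocycle of $L'$ with coefficients in $V'$, and $\{R'_\alpha:V'\to L'\}_{\alpha\in\Omega}$ a $\Phi'$-twisted Rota-Baxter family operator. If $(\phi,\varphi)$ is a morphism of twisted Rota-Baxter family operators from $\{R_\alpha\}_{\alpha\in\Omega}$ to $\{R'_\alpha\}_{\alpha\in\Omega}$, then $\phi:V\to V'$ is a morphism between the induced Hom-NS-family algebras.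
   Context: Work over a field $\mathbb{K}$ of characteristic $0$. A Hom-associative algebra $(L,\mu,p)$ is a vector space $L$ with a linear map $p:L\to L$ and a bilinear product $\mu(x,y)=x\cdot y$ such that $p(x\cdot y)=p(x)\cdot p(y)$ and $p(x)\cdot(y\cdot z)=(x\cdot y)\cdot p(z)$. A bimodule $(V,\mu_l,\mu_r,q)$ over it is a vector space $V$ with a linear map $q:V\to V$ and bilinear maps $\mu_l:L\times V\to V$, $(x,u)\mapsto x\cdot_l u$, and $\mu_r:V\times L\to V$, $(u,x)\mapsto u\cdot_r x$, such that $q(x\cdot_l u)=p(x)\cdot_l q(u)$, $q(u\cdot_r x)=q(u)\cdot_r p(x)$, $q(u)\cdot_r(x\cdot y)=(u\cdot_r x)\cdot_r p(y)$, $p(x)\cdot_l(u\cdot_r y)=(x\cdot_l u)\cdot_r p(y)$, $p(x)\cdot_l(y\cdot_l u)=(x\cdot y)\cdot_l q(u)$. A 2-cocycle of $L$ with coefficients in $V$ is a bilinear map $\Phi:L\otimes L\to V$ with $q\,\Phi(x_1,x_2)=\Phi(p(x_1),p(x_2))$ and $p(x_1)\cdot_l\Phi(x_2,x_3)-\Phi(x_1,x_2)\cdot_r p(x_3)-\Phi(x_1\cdot x_2,p(x_3))+\Phi(p(x_1),x_2\cdot x_3)=0$. A $\Phi$-twisted Rota-Baxter family operator is a collection of linear maps $\{R_\alpha:V\to L\}_{\alpha\in\Omega}$ with $R_\alpha\circ q=p\circ R_\alpha$ and $R_\alpha u\cdot R_\beta v=R_{\alpha\beta}(R_\alpha u\cdot_l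 v+u\cdot_r R_\beta v+\Phi(R_\alpha u,R_\beta v))$ for all $u,v\in V$, $\alpha,\beta\in\Omega$. A morphism from a $\Phi$-twisted Rota-Baxter family operator $\{R_\alpha:V\to L\}$ to a $\Phi'$-twisted one $\{R'_\alpha:V'\to L'\}$ is a pair $(\phi,\varphi)$ of a Hom-associative algebra morphism $\varphi:L\to L'$ (linear, multiplicative, $\varphi\circ p=p'\circ\varphi$) and a linear map $\phi:V\to V'$ with $\varphi\circ R_\alpha=R'_\alpha\circ\phi$ for all $\alpha$, $\phi\circ\Phi=\Phi'\circ(\varphi\otimes\varphi)$, $\phi\circ q=q'\circ\phi$, $\phi\circ\mu_l=\mu'_l\circ(\varphi\otimes\phi)$, $\phi\circ\mu_r=\mu'_r\circ(\phi\otimes\varphi)$. A Hom-NS-family algebra $(G,\{\prec_\alpha,\succ_\alpha,\curlyvee_{\alpha,\beta}\}_{\alpha,\beta\in\Omega},p)$ is a vector space $G$ with bilinear operations $\prec_\alpha,\succ_\alpha,\curlyvee_{\alpha,\beta}:G\times G\to G$ and a linear map $p:G\to G$ preserving each operation such that for all $x,y,z\in G$, $\alpha,\beta,\gamma\in\Omega$: $p(x)\prec_{\alpha\beta}(y\prec_\beta z+y\succ_\alpha z+y\curlyvee_{\alpha,\beta}z)=(x\prec_\alpha y)\prec_\beta p(z)$; $(x\succ_\alpha y)\prec_\beta p(z)=p(x)\succ_\alpha(y\prec_\beta z)$; $(x\prec_\beta y+x\succ_\alpha y+x\curlyvee_{\alpha,\beta}y)\succ_{\alpha\beta}p(z)=p(x)\succ_\alpha(y\succ_\beta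 z)$; $p(x)\succ_\alpha(y\curlyvee_{\beta,\gamma}z)+p(x)\curlyvee_{\alpha,\beta\gamma}(y\prec_\gamma z+y\succ_\beta z+y\curlyvee_{\beta,\gamma}z)=(x\curlyvee_{\alpha,\beta}y)\prec_\gamma p(z)+(x\prec_\beta y+x\succ_\alpha y+x\curlyvee_{\alpha,\beta}y)\curlyvee_{\alpha\beta,\gamma}p(z)$. A morphism of Hom-NS-family algebras is a linear map preserving all operations $\prec_\alpha,\succ_\alpha,\curlyvee_{\alpha,\beta}$ and commuting with the structure maps. *)

(* Defs.v *)
From HB Require Import structures.
From mathcomp Require Import all_boot all_algebra.
Set Implicit Arguments.
Unset Strict Implicit.
Unset Printing Implicit Defensive.
Import GRing.Theory.
Local Open Scope ring_scope.

Record is_hom_associative (K : fieldType) (L : lmodType K)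
    (mu : {bilinear L -> L -> L}) (p : {linear L -> L}) : Prop := {
  hom_assoc_mult : forall x y : L, p (mu x y) = mu (p x) (p y);
  hom_assoc : forall x y z : L, mu (p x) (mu y z) = mu (mu x y) (p z)
}.

Record is_hom_bimodule (K : fieldType) (L V : lmodType K)
    (mu : {bilinear L -> L -> L}) (p : {linear L -> L})
    (mul : {bilinear L -> V -> V}) (mur : {bilinear V -> L -> V})
    (q : {linear V -> V}) : Prop := {
  bimod_mult_l : forall (x : L) (u : V), q (mul x u) = mul (p x) (q u);
  bimod_mult_r : forall (u : V) (x : L), q (mur u x) = mur (q u) (p x);
  bimod_rr : forall (u : V) (x y : L), mur (q u) (mu x y) = mur (mur u x) (p y);
  bimod_lr : forall (x y : L) (u : V), mul (p x) (mur u y) = mur (mul x u) (p y);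
  bimod_ll : forall (x y : L) (u : V), mul (p x) (mul y u) = mul (mu x y) (q u)
}.

Record is_2cocycle (K : fieldType) (L V : lmodType K)
    (mu : {bilinear L -> L -> L}) (p : {linear L -> L})
    (mul : {bilinear L -> V -> V}) (mur : {bilinear V -> L -> V})
    (q : {linear V -> V}) (Phi : {bilinear L -> L -> V}) : Prop := {
  cocycle_mult : forall x1 x2 : L, q (Phi x1 x2) = Phi (p x1) (p x2);
  cocycle_eq : forall x1 x2 x3 : L,
    mul (p x1) (Phi x2 x3) - mur (Phi x1 x2) (p x3)
      - Phi (mu x1 x2) (p x3) + Phi (p x1) (mu x2 x3) = 0
}.

Record is_twisted_RB_family (K : fieldType) (Omega : semigroupType)
    (L V : lmodType K)
    (mu : {bilinear L -> L -> L}) (p : {linear L -> L})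
    (mul : {bilinear L -> V -> V}) (mur : {bilinear V -> L -> V})
    (q : {linear V -> V}) (Phi : {bilinear L -> L -> V})
    (R : Omega -> {linear V -> L}) : Prop := {
  RB_family_comm : forall (a : Omega) (u : V), R a (q u) = p (R a u);
  RB_family_eq : forall (a b : Omega) (u v : V),
    mu (R a u) (R b v) =
    R (a * b)%g (mul (R a u) v + mur u (R b v) + Phi (R a u) (R b v))
}.

Record is_hom_assoc_morphism (K : fieldType) (L L' : lmodType K)
    (mu : {bilinear L -> L -> L}) (p : {linear L -> L})
    (mu' : {bilinear L' -> L' -> L'}) (p' : {linear L' -> L'})
    (psi : {linear L -> L'}) : Prop := {
  hom_assoc_morph_mul : forall x y : L, psi (mu x y) = mu' (psi x) (psi y);
  hom_assoc_morph_map : forall x : L, psi (p x) = p' (psi x)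
}.

Record is_twisted_RB_family_morphism (K : fieldType) (Omega : semigroupType)
    (L V L' V' : lmodType K)
    (mu : {bilinear L -> L -> L}) (p : {linear L -> L})
    (mul : {bilinear L -> V -> V}) (mur : {bilinear V -> L -> V})
    (q : {linear V -> V}) (Phi : {bilinear L -> L -> V})
    (R : Omega -> {linear V -> L})
    (mu' : {bilinear L' -> L' -> L'}) (p' : {linear L' -> L'})
    (mul' : {bilinear L' -> V' -> V'}) (mur' : {bilinear V' -> L' -> V'})
    (q' : {linear V' -> V'}) (Phi' : {bilinear L' -> L' -> V'})
    (R' : Omega -> {linear V' -> L'})
    (phi : {linear V -> V'}) (psi : {linear L -> L'}) : Prop := {
  RB_morph_alg : is_hom_assoc_morphism mu p mu' p' psi;
  RB_morph_R : forall (a : Omega) (u : V), psi (R a u) = R' a (phi u);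
  RB_morph_Phi : forall x y : L, phi (Phi x y) = Phi' (psi x) (psi y);
  RB_morph_q : forall u : V, phi (q u) = q' (phi u);
  RB_morph_l : forall (x : L) (u : V), phi (mul x u) = mul' (psi x) (phi u);
  RB_morph_r : forall (u : V) (x : L), phi (mur u x) = mur' (phi u) (psi x)
}.

(* [NS_total prec succ vee a b x y] is the sum
   $x \prec_b y + x \succ_a y + x \curlyvee_{a,b} y$: the index of [prec] is
   the second one and the index of [succ] the first one. *)
Definition NS_total (Omega : Type) (G : nmodType)
    (prec succ : Omega -> G -> G -> G) (vee : Omega -> Omega -> G -> G -> G)
    (a b : Omega) (x y : G) : G :=
  prec b x y + succ a x y + vee a b x y.

(* The operations are plain functions and their bilinearity is part of the
   predicate, so that it has to be established for a given family. *)
Record is_hom_NS_family_algebra (K : fieldType) (Omega : semigroupType)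
    (G : lmodType K) (prec succ : Omega -> G -> G -> G)
    (vee : Omega -> Omega -> G -> G -> G) (p : {linear G -> G}) : Prop := {
  NS_prec_bilinear : forall a, bilinear_for *:%R *:%R (prec a);
  NS_succ_bilinear : forall a, bilinear_for *:%R *:%R (succ a);
  NS_vee_bilinear : forall a b, bilinear_for *:%R *:%R (vee a b);
  NS_prec_map : forall a x y, p (prec a x y) = prec a (p x) (p y);
  NS_succ_map : forall a x y, p (succ a x y) = succ a (p x) (p y);
  NS_vee_map : forall a b x y, p (vee a b x y) = vee a b (p x) (p y);
  NS_eq1 : forall a b x y z,
    prec (a * b)%g (p x) (NS_total prec succ vee a b y z) =
    prec b (prec a x y) (p z);
  NS_eq2 : forall a b x y z,
    prec b (succ a x y) (p z) = succ a (p x) (prec b y z);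
  NS_eq3 : forall a b x y z,
    succ (a * b)%g (NS_total prec succ vee a b x y) (p z) =
    succ a (p x) (succ b y z);
  NS_eq4 : forall a b c x y z,
    succ a (p x) (vee b c y z)
      + vee a (b * c)%g (p x) (NS_total prec succ vee b c y z) =
    prec c (vee a b x y) (p z)
      + vee (a * b)%g c (NS_total prec succ vee a b x y) (p z)
}.

Record is_hom_NS_family_morphism (K : fieldType) (Omega : semigroupType)
    (G G' : lmodType K)
    (prec succ : Omega -> G -> G -> G)
    (vee : Omega -> Omega -> G -> G -> G) (p : {linear G -> G})
    (prec' succ' : Omega -> G' -> G' -> G')
    (vee' : Omega -> Omega -> G' -> G' -> G') (p' : {linear G' -> G'})
    (phi : G -> G') : Prop := {
  NS_morph_linear : linear phi;
  NS_morph_prec : forall a x y, phi (prec a x y) = prec' a (phi x) (phi y);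
  NS_morph_succ : forall a x y, phi (succ a x y) = succ' a (phi x) (phi y);
  NS_morph_vee : forall a b x y,
    phi (vee a b x y) = vee' a b (phi x) (phi y);
  NS_morph_map : forall x, phi (p x) = p' (phi x)
}.

Section InducedOperations.

Variables (K : fieldType) (Omega : Type) (L V : lmodType K).

Definition induced_prec (mur : {bilinear V -> L -> V})
    (R : Omega -> {linear V -> L}) (a : Omega) (u v : V) : V :=
  mur u (R a v).

Definition induced_succ (mul : {bilinear L -> V -> V})
    (R : Omega -> {linear V -> L}) (a : Omega) (u v : V) : V :=
  mul (R a u) v.

Definition induced_vee (Phi : {bilinear L -> L -> V})
    (R : Omega -> {linear V -> L}) (a b : Omega) (u v : V) : V :=
  Phi (R a u) (R b v).

End InducedOperations.

(* Main.v *)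
Require Import Defs.
From HB Require Import structures.
From mathcomp Require Import all_boot all_algebra.
Set Implicit Arguments.
Unset Strict Implicit.
Unset Printing Implicit Defensive.
Import GRing.Theory.
Local Open Scope ring_scope.

(** Each induced operation is a bimodule action or [Phi] with the maps [R a] inserted in its
    [L]-slots. The twisted Rota-Baxter identity says exactly that [R (a * b)] sends the total of the
    three operations to the product of the images under [R a] and [R b]. So wherever an NS axiom
    contains a total, it becomes a product in [L]: the first three axioms turn into the three
    associativity-type axioms of the bimodule, and the fourth into the cocycle identity at [R a x],
    [R b y], [R c z]. Since [R a] intertwines [q] and [p], the structure maps match. A morphism
    intertwines the actions, [Phi] and the [R a], hence the operations built from them. *)

Lemma RB_family_NS_total (K : fieldType) (Omega : semigroupType)
    (L V : lmodType K) (mu : {bilinear L -> L -> L}) (p : {linear L -> L})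
    (mul : {bilinear L -> V -> V}) (mur : {bilinear V -> L -> V})
    (q : {linear V -> V}) (Phi : {bilinear L -> L -> V})
    (R : Omega -> {linear V -> L}) :
  is_twisted_RB_family mu p mul mur q Phi R ->
  forall (a b : Omega) (u v : V),
  R (a * b)%g (NS_total (induced_prec mur R) (induced_succ mul R)
                 (induced_vee Phi R) a b u v) = mu (R a u) (R b v).
Proof.
move=> HR a b u v; rewrite (RB_family_eq HR) /NS_total.
(* [NS_total] lists the right action first, the Rota-Baxter identity the left one. *)
by rewrite [induced_prec _ _ _ _ _ + _]addrC.
Qed.

Theorem proposition3p12 (K : fieldType) (charK0 : [pchar K] =i pred0)
  (Omega : semigroupType) (L V : lmodType K)
  (mu : {bilinear L -> L -> L}) (p : {linear L -> L})
  (mul : {bilinear L -> V -> V}) (mur : {bilinear V -> L -> V})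
  (q : {linear V -> V}) (Phi : {bilinear L -> L -> V})
  (R : Omega -> {linear V -> L})
  (HL : is_hom_associative mu p)
  (HV : is_hom_bimodule mu p mul mur q)
  (HPhi : is_2cocycle mu p mul mur q Phi)
  (HR : is_twisted_RB_family mu p mul mur q Phi R) :
  is_hom_NS_family_algebra
    (induced_prec mur R) (induced_succ mul R) (induced_vee Phi R) q
  /\
  forall (L' V' : lmodType K)
    (mu' : {bilinear L' -> L' -> L'}) (p' : {linear L' -> L'})
    (mul' : {bilinear L' -> V' -> V'}) (mur' : {bilinear V' -> L' -> V'})
    (q' : {linear V' -> V'}) (Phi' : {bilinear L' -> L' -> V'})
    (R' : Omega -> {linear V' -> L'}),
    is_hom_associative mu' p' ->
    is_hom_bimodule mu' p' mul' mur' q' ->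
    is_2cocycle mu' p' mul' mur' q' Phi' ->
    is_twisted_RB_family mu' p' mul' mur' q' Phi' R' ->
    forall (phi : {linear V -> V'}) (psi : {linear L -> L'}),
      is_twisted_RB_family_morphism mu p mul mur q Phi R
        mu' p' mul' mur' q' Phi' R' phi psi ->
      is_hom_NS_family_morphism
        (induced_prec mur R) (induced_succ mul R) (induced_vee Phi R) q
        (induced_prec mur' R') (induced_succ mul' R') (induced_vee Phi' R') q'
        phi.
Proof.
have [Rq _] := HR; have Rtot := RB_family_NS_total HR.
have [qmul qmur murr mulr mull] := HV; have [qPhi cocycle] := HPhi.
split; last first.
  move=> L' V' mu' p' mul' mur' q' Phi' R' _ _ _ _ phi psi [_ phiR phiPhi phiq].
  move=> phil phir; split=> //.
  - exact: linearP.
  - by move=> a x y; rewrite /induced_prec phir phiR.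
  - by move=> a x y; rewrite /induced_succ phil phiR.
  - by move=> a b x y; rewrite /induced_vee phiPhi !phiR.
split.
- move=> a; split=> [v k x y|u k x y]; rewrite /induced_prec.
    exact: linearPl.
  by rewrite linearP linearPr.
- move=> a; split=> [v k x y|u k x y]; rewrite /induced_succ.
    by rewrite linearP linearPl.
  exact: linearPr.
- move=> a b; split=> [v k x y|u k x y]; rewrite /induced_vee.
    by rewrite linearP linearPl.
  by rewrite linearP linearPr.
- by move=> a x y; rewrite /induced_prec qmur Rq.
- by move=> a x y; rewrite /induced_succ qmul Rq.
- by move=> a b x y; rewrite /induced_vee qPhi !Rq.
(* Only the outermost operation is unfolded, so that the total stays intact for [Rtot]. *)
- by move=> a b x y z; rewrite {1}/induced_prec Rtot murr -Rq.
- by move=> a b x y z; rewrite /induced_prec /induced_succ !Rq mulr.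
- by move=> a b x y z; rewrite {1}/induced_succ Rtot -mull -Rq.
(* Occurrences 2 and 5 are the two outer [induced_vee] having a total as an argument. *)
- move=> a b c x y z; rewrite {2 5}/induced_vee !Rtot !Rq.
  rewrite /induced_succ /induced_prec /induced_vee !Rq.
  apply/eqP; rewrite -subr_eq0 opprD addrA; apply/eqP.
  (* The zero on the right is replaced by the cocycle expression, which has the same four signed
     terms in another order. *)
  rewrite -[RHS](cocycle (R a x) (R b y) (R c z)).
  by rewrite -[LHS]addrA [LHS]addrAC [X in X + _]addrA.
Qed.
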